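(* Let $n\ge 2$ with $n\equiv 1\pmod 4$ be fixed. The number of distinct discriminants of number fields $\mathbb{Q}(\alpha)$ generated by a root $\alpha$ of a polynomial from the set $$\{X^n+aX+b~:~a,b\in\mathbb{Z},\ 1\le a,b\le H\}$$ is at least $H^{1+o(1)}$.
   Context: $H$ is a positive integer, and $o(1)$ denotes a quantity that tends to $0$ as $H\to\infty$ for fixed $n$. *)

(* Defs.v *)
From HB Require Import structures.
From mathcomp Require Import all_boot all_order all_algebra all_field.
From mathcomp Require Import finmap.
From mathcomp Require Import all_classical all_reals all_analysis.
Set Implicit Arguments.
Unset Strict Implicit.
Unset Printing Implicit Defensive.
Import Order.TTheory GRing.Theory Num.Theory.
Import numFieldNormedType.Exports.
Local Open Scope classical_set_scope.
Local Open Scope ring_scope.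

(* A number field is a K : fieldExtType rat (a finite extension of Q); its    *)
(* degree is \dim {:K}.                                                       *)

(* The trace of K / Q: the trace of the Q-linear map y |-> x * y, computed in *)
(* a basis of K (galTrace would require K / Q to be Galois).                  *)
Definition field_trace (K : fieldExtType rat) (x : K) : rat :=
  let b := vbasis {:K} in
  \tr (\matrix_(i < \dim {:K}, j < \dim {:K}) coord b j (x * b`_i)).

Definition integral_basis (K : fieldExtType rat)
    (w : (\dim {:K}).-tuple K) : Prop :=
  basis_of {:K} w /\
  forall x : K, integralOver (intr : int -> K) x <-> inIntSpan w x.

(* d = det (Tr (w_i * w_j)) for an integral basis w; the value does not       *)
(* depend on w.                                                               *)
Definition is_discriminant (K : fieldExtType rat) (d : int) : Prop :=
  exists2 w : (\dim {:K}).-tuple K, integral_basis w &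
    d%:~R = \det (\matrix_(i < \dim {:K}, j < \dim {:K})
                    field_trace (w`_i * w`_j)).

Definition trinomial (n : nat) (a b : int) : {poly int} :=
  'X^n + a *: 'X + b%:P.

(* K = Q(alpha) for a root alpha of f; f may be reducible. *)
Definition generated_by_root (K : fieldExtType rat) (f : {poly int}) : Prop :=
  exists2 alpha : K, root (map_poly (intr : int -> K) f) alpha &
    <<1%VS; alpha>>%VS = {:K}%VS.

(* Only finitely many pairs (a, b) and roots occur, so this set is finite and *)
(* its fset_set (which is empty on infinite sets) has the true cardinality.   *)
Definition trinomial_discriminants (n H : nat) : set int :=
  [set d | exists a b : int, exists K : fieldExtType rat,
    [/\ 1 <= a <= H%:Z, 1 <= b <= H%:Z,
        generated_by_root K (trinomial n a b) & is_discriminant K d]].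

(* Main.v *)
Require Import Defs.
From HB Require Import structures.
From mathcomp Require Import all_boot all_order all_algebra all_field.
From mathcomp Require Import finmap.
From mathcomp Require Import all_classical all_reals all_analysis.
From mathcomp Require Import ring lra zify.
Set Implicit Arguments.
Unset Strict Implicit.
Unset Printing Implicit Defensive.
Import Order.TTheory GRing.Theory Num.Theory.
Import numFieldNormedType.Exports.
Local Open Scope classical_set_scope.
Local Open Scope ring_scope.

(** Let K = Q(alpha) have degree n, where alpha is a root of X^n + aX + b with
    n = 2k + 1. The Gram determinant of the trace form on 1, ..., alpha^(n-1)
    is +-(n^n b^(n-1) + (n-1)^(n-1) a^n), and it differs from the discriminant
    d of K by the square of an index; hence
      |d| m^2 = n^n b^(n-1) + (n-1)^(n-1) a^n   for some integer m
    (trinomial_discriminant_square). Fix a = 2 and let b run through the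
    integers 4c + 2 up to H: all these trinomials are Eisenstein at 2, so they
    are irreducible and K does have degree n. With Y = (n b)^k the relation
    becomes the Pell-type equation
      |d| m^2 - n Y^2 = A,   A = (n-1)^(n-1) 2^n,
    in which A does not depend on b. For a given d, two solutions (m, Y) that
    agree modulo A differ by a nontrivial unit u + v sqrt(|d| n) of norm 1 with
    u >= 2, so that the larger Y is at least twice the smaller one (pell_gap).
    Therefore d, the residues of m and Y modulo A, and the integer part of
    log_2 Y together determine b: a discriminant arises from O(log H) values
    of b only (discriminant_count). About H/4 values of b are available, so
    there are at least H / (C (1 + log H)) discriminants, and the logarithm is
    absorbed by H^(o(1)) (log_loss_exponent).

    Two facts make the count meaningful. The set of discriminants is finite
    (finite_trinomial_discriminants), for otherwise its fset_set would be
    empty: the discriminant of K divides a number computed from the minimal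
    polynomial of alpha, which is one of the finitely many monic divisors of
    the trinomial. And each field has a discriminant at all, that is, an
    integral basis (integral_basis_exists): a Q-basis made of integral elements
    whose Gram determinant is as small as possible in absolute value. *)

(** * The trace form in an arbitrary basis *)

Section TraceForm.
Variable K : fieldExtType rat.
Implicit Types (x y : K).

Definition coord_mx m n (u : m.-tuple K) (w : n.-tuple K) : 'M[rat]_(m, n) :=
  \matrix_(i, j) coord w j u`_i.

(** Elements act on row vectors of coordinates, so row i holds the coordinates
    of x * w_i. *)
Definition regular_mx n (w : n.-tuple K) x : 'M[rat]_n :=
  \matrix_(i, j) coord w j (x * w`_i).

Definition gram n (u : n.-tuple K) : 'M[rat]_n :=
  \matrix_(i, j) field_trace (u`_i * u`_j).

Lemma coord_mx_row m n (u : m.-tuple K) (w : n.-tuple K) i :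
  basis_of {:K} w -> u`_i = \sum_j coord w j u`_i *: w`_j.
Proof. by move=> Bw; apply: (coord_basis Bw); rewrite memvf. Qed.

(** With u a basis this composes changes of basis; in general it expands the
    family u in the basis w. *)
Lemma mul_coord_mx m n p (u : m.-tuple K) (w : n.-tuple K) (v : p.-tuple K) :
  basis_of {:K} w -> coord_mx u w *m coord_mx w v = coord_mx u v.
Proof.
move=> Bw; apply/matrixP => i j; rewrite !mxE [in RHS](coord_mx_row u i Bw).
by rewrite linear_sum; apply: eq_bigr => k _; rewrite !mxE linearZ.
Qed.

Lemma coord_mx_id n (w : n.-tuple K) : basis_of {:K} w -> coord_mx w w = 1%:M.
Proof.
move=> Bw; apply/matrixP => i j; rewrite !mxE.
by rewrite (coord_free _ _ (basis_free Bw)).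
Qed.

Lemma coord_mx_regular m n (u : m.-tuple K) (w : n.-tuple K) x :
  basis_of {:K} u -> basis_of {:K} w ->
  regular_mx u x *m coord_mx u w = coord_mx u w *m regular_mx w x.
Proof.
move=> Bu Bw; apply/matrixP => i j; rewrite !mxE.
transitivity (coord w j (x * u`_i)).
  rewrite [x * _](coord_basis Bu (memvf _)) linear_sum.
  by apply: eq_bigr => k _; rewrite !mxE linearZ.
rewrite [in LHS](coord_mx_row u i Bw) mulr_sumr linear_sum.
by apply: eq_bigr => k _; rewrite !mxE -scalerAr linearZ.
Qed.

Lemma regular_mxM n (w : n.-tuple K) x y :
  basis_of {:K} w -> regular_mx w (x * y) = regular_mx w x *m regular_mx w y.
Proof.
move=> Bw; apply/matrixP => i j; rewrite !mxE mulrAC.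
rewrite [x * _](coord_basis Bw (memvf _)) mulr_suml linear_sum.
by apply: eq_bigr => k _; rewrite !mxE -scalerAl linearZ /= [y * _]mulrC.
Qed.

Lemma regular_mx1 n (w : n.-tuple K) :
  basis_of {:K} w -> regular_mx w 1 = 1%:M.
Proof.
move=> Bw; rewrite -(coord_mx_id Bw); apply/matrixP => i j.
by rewrite !mxE mul1r.
Qed.

Lemma regular_mx_is_linear n (w : n.-tuple K) : linear (regular_mx w).
Proof.
by move=> a x y; apply/matrixP => i j; rewrite !mxE mulrDl -scalerAl linearP.
Qed.

HB.instance Definition _ n (w : n.-tuple K) :=
  GRing.isLinear.Build rat K 'M[rat]_n *:%R (regular_mx w)
    (@regular_mx_is_linear n w).

(** The definition of the trace singles out one basis; conjugation by the change
    of basis frees it from that choice. *)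
Lemma field_trace_basis n (w : n.-tuple K) x :
  basis_of {:K} w -> field_trace x = \tr (regular_mx w x).
Proof.
move=> Bw; have Bb := vbasisP {:K}.
rewrite -[RHS](congr1 mxtrace (mulmx1 _)) -(coord_mx_id Bw).
rewrite -(mul_coord_mx w w Bb) mulmxA coord_mx_regular // -mulmxA mxtrace_mulC.
by rewrite -mulmxA mul_coord_mx // coord_mx_id // mulmx1.
Qed.

Lemma field_trace_is_scalar : scalar (@field_trace K).
Proof.
move=> a x y; have Bb := vbasisP {:K}.
by rewrite !(field_trace_basis _ Bb) linearP mxtraceD mxtraceZ.
Qed.

HB.instance Definition _ :=
  GRing.isLinear.Build rat K rat *%R (@field_trace K) field_trace_is_scalar.

Lemma gram_coord_mx m n (u : m.-tuple K) (w : n.-tuple K) :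
  basis_of {:K} w ->
  gram u = coord_mx u w *m gram w *m (coord_mx u w)^T.
Proof.
move=> Bw; apply/matrixP => i j; rewrite !mxE.
rewrite (coord_mx_row u j Bw) mulr_sumr linear_sum.
apply: eq_bigr => k _; rewrite !mxE -scalerAr linearZ /= mulrC; congr (_ * _).
rewrite [in LHS](coord_mx_row u i Bw) mulr_suml linear_sum.
by apply: eq_bigr => l _; rewrite !mxE -scalerAl linearZ.
Qed.

Lemma det_gram_coord_mx n (u w : n.-tuple K) :
  basis_of {:K} w -> \det (gram u) = \det (coord_mx u w) ^+ 2 * \det (gram w).
Proof.
by move=> /(gram_coord_mx u) ->; rewrite !det_mulmx det_tr mulrAC -expr2.
Qed.

Lemma field_trace1 : field_trace (1 : K) = (\dim {:K})%:R.
Proof.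
have Bb := vbasisP {:K}.
by rewrite (field_trace_basis _ Bb) regular_mx1 // mxtrace1.
Qed.

(** The trace form is nondegenerate: if x <> 0 were orthogonal to everything, it
    would be orthogonal to x^-1, but the trace of 1 is the degree, which is not
    zero in characteristic 0. *)
Lemma det_gram_neq0 n (w : n.-tuple K) : basis_of {:K} w -> \det (gram w) != 0.
Proof.
move=> Bw; apply/det0P => -[v nz_v vG0].
pose x := \sum_i v 0 i *: w`_i.
have nz_x : x != 0.
  apply: contra nz_v => /eqP x0; apply/eqP/rowP => i; rewrite mxE.
  by rewrite (freeP (basis_free Bw) (v 0) x0).
have Trx y : field_trace (x * y) = 0.
  rewrite (coord_basis Bw (memvf y)) mulr_sumr linear_sum big1 // => j _.
  rewrite -scalerAr linearZ /= (_ : field_trace _ = 0) ?mulr0 //.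
  move/rowP/(_ j): vG0; rewrite !mxE => vG0j; rewrite -[RHS]vG0j.
  rewrite mulr_suml linear_sum; apply: eq_bigr => i _.
  by rewrite mxE -scalerAl linearZ.
have := Trx x^-1; rewrite divff // field_trace1 => /eqP.
by rewrite pnatr_eq0 gtn_eqF // adim_gt0.
Qed.

Lemma basis_coord_mx n (u w : n.-tuple K) :
  basis_of {:K} w -> \det (coord_mx u w) != 0 -> basis_of {:K} u.
Proof.
move=> Bw nz_det; rewrite basisEfree subvf (size_basis Bw) size_tuple leqnn.
rewrite !andbT; apply/freeP => k k0 i.
have /rowP/(_ i): \row_i k i = 0 :> 'rV_n; last by rewrite !mxE.
apply: (row_free_inj (A := coord_mx u w)).
  by rewrite row_free_unit unitmxE unitfE.
rewrite mul0mx; apply/rowP => j; rewrite !mxE.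
transitivity (coord w j (\sum_i k i *: u`_i)); last by rewrite k0 linear0.
by rewrite linear_sum; apply: eq_bigr => l _; rewrite !mxE linearZ.
Qed.

End TraceForm.

(** * Integral bases and the discriminant *)

Section IntegralElements.
Variable K : fieldExtType rat.
Implicit Types (x y : K).

Notation integralZ := (integralOver (intr : int -> K)).

Lemma integral_sumMz n (w : n.-tuple K) (a : 'I_n -> int) :
  (forall i : 'I_n, integralZ w`_i) -> integralZ (\sum_(i < n) w`_i *~ a i).
Proof.
move=> intw; apply: (big_ind (fun x => integralZ x)) => [|x y|i _].
- exact: mxpoly.integral0.
- exact: integral_add.
- by rewrite -mulrzr; apply: integral_mul => //; apply: integral_id.
Qed.

(** Over the algebraic numbers the trace is the sum of the eigenvalues of the
    multiplication by x, and an eigenvalue is a root of every polynomial that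
    kills x. So the trace is a sum of algebraic integers, and it is rational. *)
Lemma field_trace_int x : integralZ x -> field_trace x \is a Num.int.
Proof.
case=> p mon_p /rootP px0; pose b := vbasis {:K}.
have Bb : basis_of {:K} b := vbasisP _.
have N_gt0 : (0 < \dim {:K})%N by rewrite adim_gt0.
pose f : {rmorphism rat -> algC} := ratr; pose A := map_mx f (regular_mx b x).
have [rs Drs] := closed_field_poly_normal (char_poly A).
rewrite (monicP (char_poly_monic A)) scale1r in Drs.
have sz_rs : size rs = \dim {:K}.
  by apply: succn_inj; rewrite -(size_prod_XsubC rs id) -Drs size_char_poly.
have trE : f (field_trace x) = \sum_(r <- rs) r.
  rewrite (field_trace_basis _ Bb) -trace_map_mx.
  apply: oppr_inj; rewrite -char_poly_trace // -/A Drs -sz_rs.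
  rewrite coefPn_prod_XsubC //.
  by rewrite sz_rs -lt0n.
rewrite -Cint_rat -[ratr _]/(f _) Cint_rat_Aint //; first exact: Crat_rat.
rewrite trE big_seq rpred_sum // => r r_rs.
have /eigenvalueP[v vA nz_v] : eigenvalue A r.
  by rewrite eigenvalue_root_char Drs root_prod_XsubC.
(* A polynomial in x acts on the eigenvector v as the same polynomial in r. *)
pose phi y := v *m map_mx f (regular_mx b y).
have phiX y k : phi (x ^+ k * y) = r ^+ k *: phi y.
  elim: k => [|k IHk]; first by rewrite mul1r scale1r.
  rewrite exprS -mulrA exprS -scalerA -IHk /phi regular_mxM // map_mxM.
  by rewrite mulmxA vA scalemxAl.
have phi_lin : {morph phi : y z / y + z}.
  by move=> y z; rewrite /phi raddfD map_mxD mulmxDr.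
have phi0 : phi 0 = 0 by rewrite /phi raddf0 map_mx0 mulmx0.
have phiZ y (m : int) : phi (m%:~R * y) = m%:~R *: phi y.
  rewrite mulrzl /phi raddfMz -scaler_int map_mxZ /= -scalemxAr.
  by rewrite /f rmorph_int.
have: phi ((map_poly intr p).[x] * 1) = (map_poly intr p).[r] *: phi 1.
  rewrite /map_poly !horner_poly.
  rewrite mulr_suml (big_morph phi phi_lin phi0) scaler_suml.
  by apply: eq_bigr => k _; rewrite -mulrA phiZ phiX scalerA.
rewrite px0 mul0r phi0 /phi regular_mx1 // map_mx1 mulmx1.
move=> /esym/eqP; rewrite scaler_eq0 (negPf nz_v) orbF => pr0.
apply: (root_monic_Aint pr0); first exact: monic_map.
by apply/polyOverP => i; rewrite coef_map /= rpred_int.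
Qed.

Lemma det_int n (A : 'M[rat]_n) :
  (forall i j, A i j \is a Num.int) -> \det A \is a Num.int.
Proof.
move=> intA; rewrite rpred_sum // => s _.
by rewrite rpredM ?rpredX ?rpredN ?rpred1 // rpred_prod.
Qed.

Lemma det_gram_int n (u : n.-tuple K) :
  (forall i : 'I_n, integralZ u`_i) -> \det (gram u) \is a Num.int.
Proof.
move=> intu; apply: det_int => i j; rewrite mxE.
by apply/field_trace_int/integral_mul.
Qed.

(** Among the bases made of integral elements, take one whose Gram determinant,
    a nonzero integer, has the least absolute value. If some integral x had a
    coordinate that is not an integer, replacing a basis vector by the element
    whose coordinates are the fractional parts of those of x would multiply the
    Gram determinant by the square of a number strictly between 0 and 1. *)
Lemma integral_basis_exists (u : (\dim {:K}).-tuple K) :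
    basis_of {:K} u -> (forall i : 'I_(\dim {:K}), integralZ u`_i) ->
  exists w : (\dim {:K}).-tuple K, integral_basis w.
Proof.
set N : nat := \dim {:K} in u *; move=> Bu intu.
pose P m := `[< exists w : N.-tuple K, [/\ basis_of {:K} w,
  forall i : 'I_N, integralZ w`_i & `|\det (gram w)| = m%:R] >].
have memP (w : N.-tuple K) : basis_of {:K} w ->
    (forall i : 'I_N, integralZ w`_i) ->
    exists2 m, P m & `|\det (gram w)| = m%:R.
  move=> Bw intw; have /intrP[d Dd] := det_gram_int intw.
  have Ed : `|\det (gram w)| = (absz d)%:R by rewrite Dd -intr_norm natr_absz.
  by exists (absz d) => //; apply/asboolP; exists w.
have exP : exists m, P m by have [m Pm _] := memP u Bu intu; exists m.
case: (ex_minnP exP) => m /asboolP[w [Bw intw Dm]] min_m.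
exists w; split=> // x; split; last by case=> a ->; apply: integral_sumMz.
move=> intx; pose c (i : 'I_N) : rat := coord w i x.
have Dx : x = \sum_i c i *: w`_i := coord_basis Bw (memvf x).
have [/forallP intc | ] := boolP [forall i, c i \is a Num.int].
  exists [ffun i => Num.floor (c i)]; rewrite {1}Dx; apply: eq_bigr => i _.
  by rewrite ffunE -scaler_int floorK.
rewrite negb_forall => /existsP[k0 ck0].
(* Taking the first bad coordinate makes the change of basis triangular. *)
have [k ck min_k] :=
  @arg_minnP _ k0 (fun i => c i \isn't a Num.int) (fun i : 'I_N => i : nat) ck0.
pose r i := c i - (Num.floor (c i))%:~R.
have r_lt (i : 'I_N) : (i < k)%N -> r i = 0.
  move=> lt_ik; apply/eqP; rewrite subr_eq0 eq_sym.
  apply: contraLR lt_ik => ci; rewrite -leqNgt min_k //.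
  by apply: contra ci => ci; rewrite floorK.
have rk_gt0 : 0 < r k.
  rewrite lt_def subr_eq0 subr_ge0 floor_le_tmp andbT.
  by apply: contra ck => /eqP->; rewrite rpred_int.
have rk_lt1 : r k < 1.
  by rewrite ltrBlDr addrC -[X in _ + X]/(1%:~R) -intrD floorD1_gt.
pose x' := \sum_i r i *: w`_i.
have intx' : integralZ x'.
  have -> : x' = x - \sum_(i < N) w`_i *~ Num.floor (c i).
    rewrite {1}Dx -sumrB; apply: eq_bigr => i _.
    by rewrite scalerBl scaler_int.
  by apply: integral_sub => //; apply: integral_sumMz.
pose w' := [tuple if i == k then x' else w`_i | i < N].
have w'E (i : 'I_N) : w'`_i = if i == k then x' else w`_i.
  by rewrite -tnth_nth tnth_mktuple.
have intw' (i : 'I_N) : integralZ w'`_i by rewrite w'E; case: ifP.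
have det_w' : \det (coord_mx w' w) = r k.
  have cE i j : coord_mx w' w i j = if i == k then r j else (i == j)%:R.
    rewrite mxE w'E; case: ifP => _; last exact: coord_free (basis_free Bw).
    by rewrite coord_sum_free ?(basis_free Bw).
  rewrite -det_tr det_trig.
    rewrite (bigD1 k) //= mxE cE eqxx big1 ?mulr1 // => i nik.
    by rewrite mxE cE (negPf nik) eqxx.
  apply/is_trig_mxP => i j lt_ij; rewrite mxE cE; case: eqP => [ejk | _].
    by rewrite r_lt // -ejk.
  by rewrite -val_eqE gtn_eqF.
have Bw' : basis_of {:K} w'.
  by apply: (basis_coord_mx Bw); rewrite det_w' gt_eqF.
have [m' Pm' Dm'] := memP w' Bw' intw'.
have := min_m m' Pm'; rewrite -(ler_nat rat) -Dm' -Dm leNgt => /negP[].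
rewrite (det_gram_coord_mx w' Bw) det_w' normrM ger0_norm ?exprn_ge0 ?ltW //.
by rewrite gtr_pMl ?expr_lt1 ?ltW // normr_gt0 det_gram_neq0.
Qed.

(** Expanding u in an integral basis gives an integer matrix; m is its
    determinant, up to sign the index of the lattice spanned by u in the ring of
    integers. *)
Lemma det_gram_discriminant n (u : n.-tuple K) d :
    basis_of {:K} u -> (forall i : 'I_n, integralZ u`_i) ->
    is_discriminant K d ->
  exists2 m : int, m != 0 & \det (gram u) = (d * m ^+ 2)%:~R.
Proof.
move=> Bu intu [w [Bw intP] Dd].
have eN := size_basis Bu; case: n / eN u Bu intu => u Bu intu.
have [m Dm] : exists m : int, \det (coord_mx u w) = m%:~R.
  apply/intrP/det_int => i j; rewrite mxE.
  have /intP[a ->] := intu i.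
  under eq_bigr do rewrite -scaler_int.
  by rewrite coord_sum_free ?(basis_free Bw) // rpred_int.
exists m; last first.
  by rewrite (det_gram_coord_mx u Bw) Dm -Dd rmorphM rmorphXn mulrC.
apply/negP => /eqP m0; have := det_gram_neq0 Bu.
by rewrite (det_gram_coord_mx u Bw) Dm m0 expr0n mul0r eqxx.
Qed.

End IntegralElements.

(** * Power bases and finiteness of the set of discriminants *)

Section PowerBasis.
Variables (K : fieldExtType rat) (alpha : K).
Hypothesis gen_alpha : <<1%VS; alpha>>%VS = {:K}%VS.

Definition powers n : n.-tuple K := [tuple alpha ^+ i | i < n].

Lemma nth_powers n (i : 'I_n) : (powers n)`_i = alpha ^+ i.
Proof. by rewrite -tnth_nth tnth_mktuple. Qed.

Lemma minimal_polynomial : exists2 g : {poly rat},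
  g \is monic & map_poly (in_alg K) g = minPoly 1 alpha.
Proof.
have /polyOver1P[g Dg] := minPolyOver 1 alpha; exists g => //.
by rewrite -(map_monic (in_alg K)) -Dg monic_minPoly.
Qed.

Lemma size_minimal_polynomial (g : {poly rat}) :
  map_poly (in_alg K) g = minPoly 1 alpha -> size g = (\dim {:K}).+1.
Proof.
move=> Dg; rewrite -(size_map_poly (in_alg K)) Dg size_minPoly; congr _.+1.
by rewrite -gen_alpha dim_Fadjoin dimv1 muln1.
Qed.

Lemma powers_basis n : n = \dim {:K} -> basis_of {:K} (powers n).
Proof.
move=> Dn; rewrite basisEdim size_tuple [X in (X <= _)%N]Dn leqnn andbT.
apply/subvP=> v _; have: v \in <<1; alpha>>%VS by rewrite gen_alpha memvf.
move/Fadjoin_poly_eq => <-.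
rewrite (@horner_coef_wide _ n) => [|]; last first.
  have -> : n = adjoin_degree 1 alpha.
    by rewrite Dn -gen_alpha dim_Fadjoin dimv1 muln1.
  exact: size_Fadjoin_poly.
rewrite memv_suml // => i _.
have /polyOverP/(_ i)/vlineP[c ->] := Fadjoin_polyOver 1 alpha v.
rewrite -scalerAl mul1r memvZ // -nth_powers memv_span // mem_nth //.
by rewrite size_tuple.
Qed.

Lemma regular_mx_powers (g : {poly rat}) :
    g \is monic -> (size g).-1 = \dim {:K} ->
    root (map_poly (in_alg K) g) alpha ->
  regular_mx (powers (size g).-1) alpha = companionmx g.
Proof.
move=> mon_g sz_g /rootP g0; have Fp := basis_free (powers_basis sz_g).
apply/matrixP => i j; rewrite !mxE nth_powers -exprS.
case: eqP => [Di | ne_i]; last first.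
  have lt_i : (i.+1 < (size g).-1)%N.
    rewrite ltn_neqAle ltn_ord andbT; apply/eqP => e; apply: ne_i.
    by move/(congr1 predn): e.
  by rewrite -(nth_powers (Ordinal lt_i)) coord_free.
have Di' : i.+1 = (size g).-1 by rewrite Di prednK // (leq_trans _ (ltn_ord i)).
have g_gt0 : (0 < size g)%N by rewrite size_poly_gt0 monic_neq0.
have -> : alpha ^+ i.+1 =
    \sum_(l < (size g).-1) - g`_l *: (powers (size g).-1)`_l.
  have E := g0; rewrite horner_coef size_map_poly -(prednK g_gt0) in E.
  rewrite big_ord_recr /= [in X in _ + X]coef_map /= -lead_coefE in E.
  rewrite (monicP mon_g) scale1r mul1r in E.
  rewrite Di' -(addr0_eq E) -sumrN.
  by apply: eq_bigr => l _; rewrite scaleNr nth_powers coef_map /= mulr_algl.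
by rewrite coord_sum_free.
Qed.

End PowerBasis.

(** The polynomial discriminant of a monic g, as the Gram determinant of the
    trace form on Q[X]/(g). Written with companion matrices it depends on g
    alone, whatever field contains a root of g. *)
Definition companion_disc (g : {poly rat}) : rat :=
  \det (\matrix_(i < (size g).-1, j < (size g).-1)
          \tr (companionmx g ^+ (i + j))).

Lemma regular_mxX (K : fieldExtType rat) n (w : n.-tuple K) x k :
  basis_of {:K} w -> regular_mx w (x ^+ k) = regular_mx w x ^+ k.
Proof.
move=> Bw; elim: k => [|k IHk]; first exact: regular_mx1.
by rewrite !exprS regular_mxM // IHk.
Qed.

Lemma det_gram_powers (K : fieldExtType rat) (alpha : K) (g : {poly rat}) :
    <<1%VS; alpha>>%VS = {:K}%VS -> g \is monic -> (size g).-1 = \dim {:K} ->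
    root (map_poly (in_alg K) g) alpha ->
  \det (gram (powers alpha (size g).-1)) = companion_disc g.
Proof.
move=> gen_a mon_g sz_g g0; have Bp := powers_basis gen_a sz_g.
congr (\det _); apply/matrixP => i j; rewrite !mxE !nth_powers -exprD.
by rewrite (field_trace_basis _ Bp) regular_mxX // regular_mx_powers.
Qed.

Lemma map_poly_intr_alg (K : fieldExtType rat) (f : {poly int}) :
  map_poly (in_alg K) (map_poly intr f) = map_poly intr f.
Proof.
rewrite -map_poly_comp; apply: eq_map_poly => z /=.
by rewrite scaler_int.
Qed.

Lemma integral_powers (K : fieldExtType rat) (alpha : K) (f : {poly int}) n :
    f \is monic -> root (map_poly intr f) alpha ->
  forall i : 'I_n, integralOver (intr : int -> K) (powers alpha n)`_i.
Proof.
move=> mon_f f0 i; rewrite nth_powers.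
have inta : integralOver (intr : int -> K) alpha by exists f.
elim: {i}(i : nat) => [|k IHk]; first exact: mxpoly.integral1.
by rewrite exprS; apply: integral_mul.
Qed.

Lemma minimal_polynomial_dvd (K : fieldExtType rat) (alpha : K)
    (g : {poly rat}) (f : {poly int}) :
    map_poly (in_alg K) g = minPoly 1 alpha -> root (map_poly intr f) alpha ->
  g %| map_poly intr f.
Proof.
move=> Dg f0; rewrite -(dvdp_map (in_alg K)) Dg map_poly_intr_alg.
rewrite minPoly_dvdp //; apply/polyOver1P.
by exists (map_poly intr f); rewrite map_poly_intr_alg.
Qed.

(** When f is reducible the degree of K is not that of f, so d is compared with
    a number attached to the minimal polynomial of alpha instead of f. *)
Lemma companion_disc_discriminant (K : fieldExtType rat) (f : {poly int}) d :
    f \is monic -> generated_by_root K f -> is_discriminant K d ->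
  exists g : {poly rat}, [/\ g \is monic, g %| map_poly intr f &
    exists2 m : int, m != 0 & companion_disc g = (d * m ^+ 2)%:~R].
Proof.
move=> mon_f [alpha f0 gen_a] disc_d.
have [g mon_g Dg] := minimal_polynomial alpha.
have sz_g := size_minimal_polynomial gen_a Dg.
have sz_g1 : (size g).-1 = \dim {:K} by rewrite sz_g.
exists g; split=> //; first exact: minimal_polynomial_dvd Dg f0.
rewrite -(det_gram_powers gen_a) ?Dg ?root_minPoly //.
apply: det_gram_discriminant disc_d; first exact: powers_basis.
exact: integral_powers mon_f f0.
Qed.

(** K is generated by a complex root of f, whose powers supply the integral
    elements from which an integral basis is made. *)
Lemma exists_discriminant (f : {poly int}) :
    f \is monic -> (1 < size f)%N ->
  exists (K : fieldExtType rat) (d : int),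
    generated_by_root K f /\ is_discriminant K d.
Proof.
move=> mon_f sz_f.
have [z fz0] : exists z, root (map_poly intr f : {poly algC}) z.
  by apply/closed_rootP; rewrite size_map_inj_poly ?gtn_eqF //; apply: intr_inj.
have [K [KC [[|alpha []] // [Da] gen_a]]] := num_field_exists [:: z].
have fa0 : root (map_poly (intr : int -> K) f) alpha.
  rewrite -(fmorph_root KC) Da -map_poly_comp (@eq_map_poly _ _ _ intr) // => m.
  by rewrite /= rmorph_int.
rewrite adjoin_seq1 in gen_a.
have Bp := powers_basis gen_a erefl.
have intp := integral_powers (n := \dim {:K}) mon_f fa0.
have [w [Bw intw]] := integral_basis_exists Bp intp.
have /intrP[d Dd] : \det (gram w) \is a Num.int.
  apply: det_gram_int => i; apply/intw; exists [ffun j => (i == j)%:R : int].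
  rewrite (bigD1 i) //= ffunE eqxx big1 ?addr0 // => j nji.
  by rewrite ffunE eq_sym (negPf nji).
by exists K, d; split; [exists alpha | exists w].
Qed.

(** Over the algebraic numbers a monic divisor of f is the product of the linear
    factors of f selected by a mask. *)
Lemma finite_monic_divisors (f : {poly rat}) : f != 0 ->
  finite_set [set g : {poly rat} | g \is monic /\ g %| f].
Proof.
move=> nz_f; pose toC : {poly rat} -> {poly algC} := map_poly ratr.
have [rs Drs] := closed_field_poly_normal (toC f).
have inj_toC : injective toC by apply: map_poly_inj.
pose F (m : (size rs).-tuple bool) := \prod_(r <- mask m rs) ('X - r%:P).
apply: (@sub_finite_set _ _ (toC @^-1` (range F))) => [g [mon_g dv_gf] /=|].
  have : toC g %| \prod_(r <- rs) ('X - r%:P).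
    rewrite -(@dvdpZr _ (lead_coef (toC f))).
      by rewrite -Drs dvdp_map.
    by rewrite lead_coef_eq0 map_poly_eq0.
  case/dvdp_prod_XsubC => m; have [m' sz_m' ->] := resize_mask m rs => eq_g.
  exists (tcast sz_m' (in_tuple m')) => //; rewrite /F val_tcast /=.
  apply/esym/eqP; rewrite -eqp_monic ?monic_prod_XsubC //.
  by rewrite monic_map.
apply: finite_preimage; first by move=> x y _ _; apply: inj_toC.
exact/finite_image/finite_finset.
Qed.

Lemma finite_int_ball (q : rat) : finite_set [set d : int | `|d|%:~R <= q].
Proof.
apply: (@sub_finite_set _ _ (range (fun i : 'I_(Num.bound q) * bool =>
   if i.2 then - (i.1%:Z) else i.1%:Z))) => [d /= le_dq|].
  have lt_d : (absz d < Num.bound q)%N.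
    rewrite -(ltr_nat rat) natr_absz (le_lt_trans le_dq) //.
    by apply: archi_boundP; apply: le_trans le_dq; rewrite ler0z.
  exists (Ordinal lt_d, d < 0) => //=.
  by case: ltP => [/ltr0_norm|/ger0_norm] Ed; rewrite abszE Ed ?opprK.
exact/finite_image/finite_finset.
Qed.

Lemma monic_trinomial n a b : (1 < n)%N -> trinomial n a b \is monic.
Proof.
move=> n_gt1; rewrite /trinomial -addrA monicE lead_coefDl ?lead_coefXn //.
rewrite size_polyXn ltnS (leq_trans (size_polyD _ _)) // geq_max.
rewrite (leq_trans (size_scale_leq _ _)) ?size_polyX //.
by rewrite (leq_trans (size_polyC_leq1 _)) // ltnW.
Qed.

Lemma size_trinomial n a b : (1 < n)%N -> size (trinomial n a b) = n.+1.
Proof.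
move=> n_gt1; rewrite /trinomial -addrA size_polyDl ?size_polyXn //.
rewrite ltnS (leq_trans (size_polyD _ _)) // geq_max.
rewrite (leq_trans (size_scale_leq _ _)) ?size_polyX //.
by rewrite (leq_trans (size_polyC_leq1 _)) // ltnW.
Qed.

Lemma finite_trinomial_discriminants n H : (1 < n)%N ->
  finite_set (trinomial_discriminants n H).
Proof.
move=> n_gt1; pose box := [set a : int | `|a|%:~R <= H%:R :> rat].
pose D (ab : int * int) := [set d : int | exists2 g : {poly rat},
  (g \is monic /\ g %| map_poly intr (trinomial n ab.1 ab.2)) &
  `|d|%:~R <= `|companion_disc g|].
have in_box (a : int) : 1 <= a <= H%:Z -> box a.
  case/andP=> a_ge1 le_aH; rewrite /box /= ger0_norm ?(le_trans _ a_ge1) //.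
  by rewrite -(ler_int rat) in le_aH.
apply: (@sub_finite_set _ _ (\bigcup_(ab in box `*` box) D ab)).
  move=> d [a [b [K [/in_box a_box /in_box b_box gen_K disc_d]]]].
  exists (a, b) => //.
  have [g [mon_g dv_g [m nz_m Dm]]] :=
    companion_disc_discriminant (monic_trinomial a b n_gt1) gen_K disc_d.
  exists g => //; rewrite Dm -intr_norm ler_int normrM ler_peMr //.
  by rewrite normrX exprn_ege1 // -gtz0_ge1 normr_gt0.
apply: bigcup_finite; first by apply: finite_setX; apply: finite_int_ball.
move=> [a b] _; rewrite /D /=.
have nz_f : map_poly intr (trinomial n a b) != 0 :> {poly rat}.
  by rewrite monic_neq0 // monic_map // monic_trinomial.
apply: (@sub_finite_set _ _ (\bigcup_(g in [set g : {poly rat} | g \is monic /\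
     g %| map_poly intr (trinomial n a b)])
     [set d : int | `|d|%:~R <= `|companion_disc g|])).
  by move=> d [g g_in le_d]; exists g.
apply: bigcup_finite; first exact: finite_monic_divisors.
by move=> g _; apply: finite_int_ball.
Qed.

(** * The discriminant of a trinomial *)

Lemma char_poly_regular_powers (K : fieldExtType rat) (alpha : K)
    (g : {poly rat}) n :
    <<1%VS; alpha>>%VS = {:K}%VS -> g \is monic -> n = \dim {:K} ->
    size g = n.+1 -> root (map_poly (in_alg K) g) alpha ->
  char_poly (regular_mx (powers alpha n) alpha) = g.
Proof.
move=> gen_a mon_g Dn sz_g g0; have En : n = (size g).-1 by rewrite sz_g.
by rewrite En in Dn *; rewrite regular_mx_powers // companionmxK.
Qed.

Lemma horner_char_poly (F : fieldType) n (A : 'M[F]_n) x :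
  (char_poly A).[x] = \det (x%:M - A).
Proof.
rewrite -[_.[x]]/(horner_eval x _) -det_map_mx; congr (\det _).
apply/matrixP => i j; rewrite !mxE /=.
by rewrite horner_evalE !(hornerE, hornerMn).
Qed.

(** The degree is p + 1. The functional lambda, the coefficient of alpha^p,
    expresses the trace by means of f'(alpha): Tr(x) = lambda(x f'(alpha)) for
    f = X^(p+1) + aX + b (a case of Euler's formula for the dual basis). The
    matrix of lambda on products of powers of alpha is antitriangular with ones
    on the antidiagonal, so the Gram determinant is, up to sign, the norm of
    f'(alpha). That norm is found from alpha f'(alpha) = -p a alpha - (p+1) b,
    whose norm is, up to a factor, the value of f at a rational number. *)
Section TrinomialField.
Variables (p : nat) (a b : rat) (K : fieldExtType rat) (alpha : K).
Hypothesis p_gt0 : (0 < p)%N.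
Hypothesis dimK : \dim {:K} = p.+1.
Hypothesis gen_alpha : <<1%VS; alpha>>%VS = {:K}%VS.
Hypothesis alphaE : alpha ^+ p.+1 = - (a *: alpha) - b *: 1.

Let e := powers alpha p.+1.
Let Be : basis_of {:K} e := powers_basis gen_alpha (esym dimK).
Let lambda : K -> rat := coord e ord_max.

Let lambdaX k : (k <= p)%N -> lambda (alpha ^+ k) = (k == p)%:R.
Proof.
rewrite -ltnS => lt_k; rewrite -(nth_powers alpha (Ordinal lt_k)) /lambda.
by rewrite coord_free ?(basis_free Be).
Qed.

Let lambdaD : {morph lambda : x y / x + y}.
Proof. by move=> x y; rewrite /lambda linearD. Qed.

Let lambdaZ c x : lambda (c *: x) = c * lambda x.
Proof. by rewrite /lambda linearZ. Qed.

Let lambda_coord (g : K -> K) : linear g -> forall x,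
  lambda (g x) = \sum_(j < p.+1) coord e j x * lambda (g (alpha ^+ j)).
Proof.
move=> g_lin x; pose gl : {linear K -> K} := 
  HB.pack g (GRing.isLinear.Build rat K K *:%R g g_lin).
rewrite -[g]/(gl : K -> K) [in LHS](coord_basis Be (memvf x)).
rewrite linear_sum /lambda linear_sum; apply: eq_bigr => j _.
by rewrite linearZ linearZ /= nth_powers.
Qed.

Let mulr_linear (z : K) : linear (fun x : K => x * z).
Proof. by move=> c x y; rewrite mulrDl scalerAl. Qed.

(* The elements alpha^(p-i) for i > 0, with alpha^p + a for i = 0, form the
   basis dual to the powers of alpha under lambda. *)
Let coordS (i : 'I_p.+1) x :
  (0 < i)%N -> coord e i x = lambda (x * alpha ^+ (p - i)).
Proof.
move=> i_gt0; rewrite (lambda_coord (mulr_linear _)) (bigD1 i) //= -exprD.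
rewrite subnKC -1?ltnS // lambdaX // eqxx mulr1 big1 ?addr0 // => j nji.
rewrite -exprD; apply/eqP; rewrite mulf_eq0; apply/orP; right; apply/eqP.
have [lt_ji | lt_ij | /val_inj/eqP] := ltngtP j i; last by rewrite (negPf nji).
  have le_ip : (i <= p)%N by rewrite -ltnS.
  have lt_p : (j + (p - i) < p)%N by lia.
  by rewrite lambdaX 1?ltnW // ltn_eqF.
have le_jp : (j <= p)%N by rewrite -ltnS.
have -> : (j + (p - i) = (j - i.+1) + p.+1)%N by lia.
rewrite exprD alphaE mulrBr mulrN -!scalerAr mulr1 -exprSr -!scaleNr.
rewrite lambdaD !lambdaZ.
rewrite !lambdaX; try lia.
by rewrite !ltn_eqF ?mulr0 ?addr0 //; lia.
Qed.

Let coord_0 x : coord e ord0 x = lambda (x * (alpha ^+ p + a *: 1)).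
Proof.
rewrite (lambda_coord (mulr_linear _)) big_ord_recl /= expr0 mul1r.
rewrite lambdaD lambdaZ -[X in a * lambda X](expr0 alpha) !lambdaX //.
rewrite eqxx ltn_eqF // mulr0 addr0 mulr1.
rewrite big1 ?addr0 // => j _; rewrite /bump /= add1n.
rewrite exprSr -mulrA mulrDr -exprS alphaE -scalerAr mulr1 addrAC addNr add0r.
rewrite mulrN -scalerAr mulr1 -scaleNr lambdaZ lambdaX ?ltn_eqF ?mulr0 //.
exact: ltnW.
Qed.

(* y is f'(alpha). *)
Let y := p.+1%:R *: alpha ^+ p + a *: 1.

Lemma trace_trinomial x : field_trace x = lambda (x * y).
Proof.
rewrite (field_trace_basis _ Be) /mxtrace big_ord_recl mxE coord_0.
rewrite nth_powers expr0 mulr1.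
under eq_bigr => i _.
  rewrite mxE nth_powers coordS // -mulrA -exprD subnKC; last exact: ltn_ord.
  over.
rewrite sumr_const card_ord -mulr_natl -lambdaZ -lambdaD; congr lambda.
rewrite /y mulrDr [in RHS]mulrDr -scalerAr addrAC; congr (_ + _).
by rewrite -natr1 scalerDl scale1r mulrDr -scalerAr addrC.
Qed.

Let pairing : 'M[rat]_p.+1 := \matrix_(i, j) lambda (alpha ^+ (i + j)).

Let det_pairing_sqr : \det pairing ^+ 2 = 1.
Proof.
(* J reverses the columns and is an involution, so det J ^ 2 = 1. *)
pose J : 'M[rat]_p.+1 := \matrix_(i, j) (j == rev_ord i)%:R.
have JJ : J *m J = 1%:M.
  apply/matrixP => i j; rewrite !mxE (bigD1 (rev_ord i)) //= !mxE eqxx mul1r.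
  rewrite rev_ordK [i == j]eq_sym big1 ?addr0 // => k nk.
  by rewrite !mxE (negPf nk) mul0r.
have : \det (pairing *m J) = 1.
  have PJ i j : (pairing *m J) i j = lambda (alpha ^+ (i + (p - j))).
    rewrite mxE (bigD1 (rev_ord j)) //= big1 => [|k nk].
      by rewrite !mxE rev_ordK eqxx mulr1 addr0 /= subSS.
    rewrite !mxE (_ : _ == _ = false) ?mulr0 //.
    by apply: contraNF nk => /eqP->; rewrite rev_ordK.
  rewrite det_trig; last first.
    apply/is_trig_mxP => i j lt_ij; rewrite PJ.
    have le_jp : (j <= p)%N by rewrite -ltnS.
    by rewrite lambdaX ?ltn_eqF //; lia.
  rewrite big1 // => i _; rewrite PJ subnKC ?lambdaX ?eqxx //.
  by rewrite -ltnS.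
have := congr1 determinant JJ; rewrite !det_mulmx det1 => detJ detPJ.
by rewrite -[LHS]mulr1 -detJ expr2 mulrACA detPJ mulr1.
Qed.

Let gramE : gram e = regular_mx e y *m pairing.
Proof.
apply/matrixP => i j; rewrite !mxE trace_trinomial !nth_powers.
rewrite [X in lambda X](_ : _ = (y * alpha ^+ i) * alpha ^+ j); last first.
  by rewrite mulrC mulrA.
rewrite (lambda_coord (mulr_linear _)); apply: eq_bigr => k _.
by rewrite !mxE nth_powers exprD.
Qed.

Let g : {poly rat} := 'X^(p.+1) + a *: 'X + b%:P.

Let char_poly_alpha : char_poly (regular_mx e alpha) = g.
Proof.
have sz_r : (size (a *: 'X + b%:P)%R <= p.+1)%N.
  rewrite (leq_trans (size_polyD _ _)) // geq_max.
  rewrite (leq_trans (size_scale_leq _ _)) ?size_polyX //.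
  by rewrite (leq_trans (size_polyC_leq1 _)).
apply: char_poly_regular_powers => //.
- by rewrite monicE /g -addrA lead_coefDl ?lead_coefXn // size_polyXn ltnS.
- by rewrite /g -addrA size_polyDl size_polyXn // ltnS.
apply/rootP; rewrite /g !rmorphD /= map_polyXn map_polyZ map_polyX map_polyC /=.
rewrite !hornerE /= alphaE mulr_algl; ring.
Qed.

(** Both sides are squared because the sign of the antitriangular determinant
    depends on p modulo 4, while the Pell-type equation below involves only the
    absolute value of the discriminant. *)
Lemma det_gram_trinomial : odd p.+1 -> a != 0 -> b != 0 ->
  \det (gram e) ^+ 2 =
    (p.+1%:R ^+ p.+1 * b ^+ p + p%:R ^+ p * a ^+ p.+1) ^+ 2.
Proof.
move=> odd_n nz_a nz_b; rewrite gramE det_mulmx exprMn det_pairing_sqr mulr1.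
congr (_ ^+ 2); set D := RHS.
have nz_p : p%:R != 0 :> rat by rewrite pnatr_eq0 -lt0n.
have detA : \det (regular_mx e alpha) = - b.
  have := char_poly_det (regular_mx e alpha); rewrite char_poly_alpha /g.
  rewrite -signr_odd odd_n mulN1r => /eqP; rewrite -eqr_oppLR => /eqP <-.
  by rewrite !(coefD, coefZ, coefX, coefXn, coefC) /= mulr0 !add0r.
have ay : alpha * y = - (p%:R * a) *: alpha - (p.+1%:R * b) *: 1.
  rewrite /y mulrDr -scalerAr -exprS alphaE -scalerAr mulr1 scalerBr scalerN.
  rewrite addrAC !scalerA; congr (_ - _).
  by rewrite -scaleNr -scalerDl; congr (_ *: _); rewrite -natr1; ring.
(* alpha y is a multiple of c - alpha, whose norm is f(c). *)
pose c := - (p.+1%:R * b) / (p%:R * a).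
have : \det (regular_mx e (alpha * y)) = - b * D.
  have -> : regular_mx e (alpha * y) =
      (p%:R * a) *: (c%:M - regular_mx e alpha).
    rewrite ay raddfB /= !linearZ /= regular_mx1 // scalerBr -scaleNr addrC.
    congr (_ + _); rewrite scalerN -(scalemx1 _ c) scalerA -scaleNr.
    congr (_ *: _).
    by rewrite /c; field; rewrite nz_a.
  have sc : p%:R * a * c = - (p.+1%:R * b).
    by rewrite /c; field; rewrite nz_a.
  have ac : a * c + b = - b / p%:R.
    by rewrite /c -natr1; field; rewrite nz_p nz_a.
  clearbody c; rewrite detZ -horner_char_poly char_poly_alpha /g !hornerE /=.
  rewrite -addrA ac.
  rewrite mulrDr -exprMn sc exprNn -signr_odd odd_n expr1 !exprMn /D.
  rewrite [b ^+ p.+1]exprS [p%:R ^+ p.+1]exprS.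
  move: (p.+1%:R ^+ p.+1) (b ^+ p) (p%:R ^+ p) (a ^+ p.+1) => u1 u2 u3 u4.
  by field.
rewrite regular_mxM // det_mulmx detA => /mulfI; apply.
by rewrite oppr_eq0.
Qed.
End TrinomialField.

(** * From discriminants to a Pell-type equation *)

Lemma generated_dim (K : fieldExtType rat) (f : {poly int}) :
    f \is monic -> irreducible_poly f -> generated_by_root K f ->
  \dim {:K} = (size f).-1.
Proof.
move=> mon_f /irreducible_rat_int[_ irr_f] [alpha f0 gen_a].
have [g mon_g Dg] := minimal_polynomial alpha.
have sz_g := size_minimal_polynomial gen_a Dg.
have dv_g := minimal_polynomial_dvd Dg f0.
have nc_g : size g != 1%N by rewrite sz_g eqSS gtn_eqF // adim_gt0.
have := eqp_size (irr_f g nc_g dv_g).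
by rewrite sz_g size_map_inj_poly //; [move <-|exact: intr_inj].
Qed.

Lemma trinomial_discriminant_square (n a b : nat) (K : fieldExtType rat) d :
    odd n -> (1 < n)%N -> (0 < a)%N -> (0 < b)%N ->
    irreducible_poly (trinomial n a b) ->
    generated_by_root K (trinomial n a b) -> is_discriminant K d ->
  exists m, (absz d * m ^ 2 = n ^ n * b ^ n.-1 + n.-1 ^ n.-1 * a ^ n)%N.
Proof.
case: n => [//|p] odd_n p_gt0 a_gt0 b_gt0 irr_f gen_K disc_d.
have mon_f := monic_trinomial (n := p.+1) a b p_gt0.
have := generated_dim mon_f irr_f gen_K; rewrite size_trinomial //= => dimK.
case: gen_K => alpha f0 gen_a.
have Ba := powers_basis gen_a (esym dimK).
have [m _ Dm] := det_gram_discriminant Ba (integral_powers mon_f f0) disc_d.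
exists (absz m).
have alphaE : alpha ^+ p.+1 = - ((a%:R : rat) *: alpha) - (b%:R : rat) *: 1.
  move/rootP: f0; rewrite /trinomial !rmorphD /= map_polyXn map_polyZ map_polyX.
  rewrite map_polyC /= !hornerE /= => /eqP; rewrite -addrA addr_eq0 => /eqP ->.
  rewrite opprD scaler_nat mulr_natl; congr (- _ - _).
  by rewrite scaler_nat.
have nz_nat k : (0 < k)%N -> k%:R != 0 :> rat by rewrite pnatr_eq0 lt0n.
have := det_gram_trinomial p_gt0 dimK gen_a alphaE odd_n (nz_nat a a_gt0)
  (nz_nat b b_gt0).
rewrite Dm -!natrX -!natrM -natrD; set T := (X in X%:R) => /eqP.
rewrite eqf_sqr pmulrn -mulrNz !eqr_int => /pred2P DT.
have -> : (absz d * absz m ^ 2 = absz (d * m ^+ 2)%R)%N by rewrite abszM abszX.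
by case: DT => ->; rewrite ?abszN.
Qed.

(** Put X = D m1 m2 - n Y1 Y2 and W = m1 Y2 - m2 Y1. In terms of the norm form,
    X + W sqrt(D n) is the product of one solution with the conjugate of the
    other, so X^2 - D n W^2 = A^2. The congruences make A divide X, and
    X > A > 0 then gives X >= 2 A, while A Y2 = X Y1 + D W m1. *)
Lemma pell_gap (D n A m1 m2 Y1 Y2 : int) :
    0 < A -> 0 < n -> 0 <= D -> 0 <= m1 -> 0 <= m2 -> 0 <= Y1 -> Y1 < Y2 ->
    (A %| m2 - m1)%Z -> (A %| Y2 - Y1)%Z ->
    D * m1 ^+ 2 = n * Y1 ^+ 2 + A -> D * m2 ^+ 2 = n * Y2 ^+ 2 + A ->
  2 * Y1 <= Y2.
Proof.
move=> A_gt0 n_gt0 D_ge0 m1_ge0 m2_ge0 Y1_ge0 ltY.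
move=> /dvdzP[s Ds] /dvdzP[t Dt] E1 E2.
pose u := 1 + D * m1 * s - n * Y1 * t.
pose X := D * m1 * m2 - n * Y1 * Y2.
have DX : X = u * A.
  rewrite /X.
  have -> : m2 = m1 + s * A by rewrite -Ds addrC subrK.
  have -> : Y2 = Y1 + t * A by rewrite -Dt addrC subrK.
  transitivity (D * m1 ^+ 2 - n * Y1 ^+ 2 + (u - 1) * A).
    by rewrite /u; ring.
  by rewrite E1; ring.
pose W := m1 * Y2 - m2 * Y1.
have D_gt0 : 0 < D.
  rewrite lt_def D_ge0 andbT; apply/eqP => D0; move: E1; rewrite D0 mul0r.
  apply/eqP; rewrite lt_eqF // ltr_wpDl // mulr_ge0 ?sqr_ge0 //; exact: ltW.
have Y2_ge0 : 0 <= Y2 by apply: le_trans (ltW ltY).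
have W_gt0 : 0 < W.
  rewrite subr_gt0 -(@ltr_pXn2r _ 2) ?nnegrE ?mulr_ge0 //.
  rewrite -(ltr_pM2l D_gt0) !exprMn [in X in X < _]mulrA [in X in _ < X]mulrA.
  rewrite E1 E2 -subr_gt0.
  have -> : (n * Y1 ^+ 2 + A) * Y2 ^+ 2 - (n * Y2 ^+ 2 + A) * Y1 ^+ 2 =
    A * (Y2 ^+ 2 - Y1 ^+ 2) by ring.
  by rewrite mulr_gt0 // subr_gt0 ltr_pXn2r.
have X_gt0 : 0 < X.
  rewrite subr_gt0 -(@ltr_pXn2r _ 2) ?nnegrE ?mulr_ge0 ?(ltW n_gt0) //.
  have -> : (D * m1 * m2) ^+ 2 = (n * Y1 ^+ 2 + A) * (n * Y2 ^+ 2 + A).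
    by rewrite -E1 -E2; ring.
  rewrite -subr_gt0.
  have -> : (n * Y1 ^+ 2 + A) * (n * Y2 ^+ 2 + A) - (n * Y1 * Y2) ^+ 2 =
    A * (n * Y1 ^+ 2 + n * Y2 ^+ 2 + A) by ring.
  by rewrite mulr_gt0 // ltr_wpDl ?addr_ge0 ?mulr_ge0 ?sqr_ge0 ?(ltW n_gt0).
have X2 : X ^+ 2 = A ^+ 2 + D * n * W ^+ 2.
  transitivity ((D * m1 ^+ 2 - n * Y1 ^+ 2) * (D * m2 ^+ 2 - n * Y2 ^+ 2) +
      D * n * W ^+ 2).
    by rewrite /X /W; ring.
  by rewrite E1 E2; ring.
have ltAX : A < X.
  rewrite -(@ltr_pXn2r _ 2) ?nnegrE ?(ltW A_gt0) ?(ltW X_gt0) // X2.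
  by rewrite ltrDl !mulr_gt0 // exprn_gt0.
have u_ge2 : 2 <= u.
  rewrite -[2]/(1 + 1 : int) lez1D.
  by rewrite DX -[X in X < _]mul1r ltr_pM2r // in ltAX.
have DY2 : A * Y2 = u * A * Y1 + D * W * m1.
  rewrite -DX; transitivity ((D * m1 ^+ 2 - n * Y1 ^+ 2) * Y2).
    by rewrite E1; ring.
  by rewrite /X /W; ring.
rewrite -(ler_pM2l A_gt0) DY2; apply: (le_trans (y := u * A * Y1)).
  by rewrite mulrCA -mulrA ler_wpM2r // mulr_ge0 // ltW.
by rewrite lerDl !mulr_ge0 // ltW.
Qed.

(** * Counting the discriminants *)

Lemma pell_gap_nat (D n A m1 m2 Y1 Y2 : nat) :
    (0 < A)%N -> (0 < n)%N -> (Y1 < Y2)%N ->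
    m1 = m2 %[mod A] -> Y1 = Y2 %[mod A] ->
    (D * m1 ^ 2 = n * Y1 ^ 2 + A)%N -> (D * m2 ^ 2 = n * Y2 ^ 2 + A)%N ->
  (2 * Y1 <= Y2)%N.
Proof.
move=> A_gt0 n_gt0 ltY em eY E1 E2.
have dvd_diff (x1 x2 : nat) : x1 = x2 %[mod A] -> (A %| x2%:Z - x1%:Z)%Z.
  by move=> ex; rewrite -eqz_mod_dvd !modz_nat ex.
rewrite -lez_nat PoszM.
apply: (@pell_gap D n A m1 m2); rewrite ?dvd_diff //.
- by move/(congr1 Posz): E1; rewrite -!mulnn PoszD !PoszM !expr2.
- by move/(congr1 Posz): E2; rewrite -!mulnn PoszD !PoszM !expr2.
Qed.

(** Eisenstein's criterion at 2: the constant term is 2 modulo 4. *)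
Lemma irreducible_trinomial n c : (1 < n)%N ->
  irreducible_poly (trinomial n 2%N (4 * c + 2)%N).
Proof.
move=> n_gt1; apply: (@eisenstein_crit 2) => //; rewrite ?size_trinomial //.
- by rewrite gtn_eqF // ltnW.
- by rewrite (monicP (monic_trinomial _ _ n_gt1)).
- rewrite /trinomial !(coefD, coefZ, coefX, coefXn, coefC) /= mulr0 addr0.
  rewrite eq_sym gtn_eqF ?add0r ?(ltnW n_gt1) //.
  by rewrite dvdzE /=; lia.
move=> i lt_in; rewrite /trinomial !(coefD, coefZ, coefX, coefXn, coefC) /=.
rewrite ltn_eqF // add0r rpredD //; first by rewrite dvdz_mulr.
by case: ifP => // _; rewrite dvdzE /=; lia.
Qed.

(** The left-hand side is the number of c with 4c + 2 <= H. Each such c is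
    sent to a discriminant d, to the residues modulo A of m and
    Y = (n (4c + 2))^(n/2), and to the integer part of log_2 Y; this map is
    injective because two values of Y with the same image would differ by a
    factor of at least 2. *)
Lemma discriminant_count n H (A := (n.-1 ^ n.-1 * 2 ^ n)%N) :
    odd n -> (1 < n)%N ->
  ((H + 2) %/ 4 <= #|` fset_set (trinomial_discriminants n H)| *
      (A * A * (trunc_log 2 ((n * H) ^ n./2)).+1))%N.
Proof.
move=> odd_n n_gt1; set S := fset_set _; set L := trunc_log _ _.
have finS := finite_trinomial_discriminants H n_gt1.
have n_gt0 : (0 < n)%N by apply: ltnW.
have A_gt0 : (0 < A)%N by rewrite muln_gt0 !expn_gt0 -ltnS prednK // n_gt1.
pose b i := (4 * i + 2)%N.
pose Y i := ((n * b i) ^ n./2)%N.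
have half_gt0 : (0 < n./2)%N by rewrite half_gt0.
have dataP (i : 'I_((H + 2) %/ 4)) : exists dm : int * nat,
    dm.1 \in S /\ (absz dm.1 * dm.2 ^ 2 = n * Y i ^ 2 + A)%N.
  have mon_f := monic_trinomial 2%N (b i) n_gt1.
  have [|K [d [gen_K disc_d]]] := exists_discriminant mon_f.
    by rewrite size_trinomial // ltnS ltnW.
  have b_gt0 : (0 < b i)%N by rewrite /b addn2.
  have [m Dm] := @trinomial_discriminant_square n 2 (b i) K d odd_n n_gt1 isT
    b_gt0 (irreducible_trinomial i n_gt1) gen_K disc_d.
  exists (d, m); split => /=.
    rewrite in_fset_set // inE /=; exists 2%N, (b i), K.
    by split=> //; have := ltn_ord i; rewrite /b; lia.
  rewrite Dm /A; congr (_ + _)%N.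
  rewrite /Y -expnM muln2 expnMn mulnA.
  have Dn : n = (n./2.*2).+1 by rewrite -[LHS]odd_double_half odd_n.
  by rewrite -expnS -Dn; congr (_ * b i ^ _)%N; rewrite {1}Dn.
have [dm dmP] := choice dataP.
have dmS i : (dm i).1 \in S by have [] := dmP i.
have dmE i : (absz (dm i).1 * (dm i).2 ^ 2 = n * Y i ^ 2 + A)%N.
  by have [] := dmP i.
have Y_gt0 i : (0 < Y i)%N by rewrite expn_gt0 muln_gt0 n_gt0 /b addn2.
have Y_inj i j : (Y i < Y j)%N = (i < j)%N.
  by rewrite /Y ltn_exp2r // ltn_pmul2l // /b ltn_add2r ltn_pmul2l.
have Y_log (i : 'I_((H + 2) %/ 4)) : (trunc_log 2 (Y i) < L.+1)%N.
  rewrite ltnS leq_trunc_log // leq_exp2r // leq_pmul2l // /b.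
  by have := ltn_ord i; lia.
pose F (i : 'I_((H + 2) %/ 4)) : S * ('I_A * 'I_A * 'I_L.+1) :=
  ([` dmS i]%fset, (Ordinal (ltn_pmod (dm i).2 A_gt0),
     Ordinal (ltn_pmod (Y i) A_gt0), Ordinal (Y_log i))).
have F_lt i j : F i = F j -> ~~ (i < j)%N.
  case=> ed em eY eL; apply/negP => lt_ij.
  have ltY : (Y i < Y j)%N by rewrite Y_inj.
  have leY : (2 * Y i <= Y j)%N.
    apply: (pell_gap_nat A_gt0 n_gt0 ltY em eY (dmE i)).
    by rewrite ed; apply: dmE.
  have /andP[lo _] := trunc_log_bounds (isT : 1 < 2)%N (Y_gt0 i).
  have /andP[_ hi] := trunc_log_bounds (isT : 1 < 2)%N (Y_gt0 j).
  have := leq_ltn_trans leY hi; rewrite -eL expnS ltn_pmul2l // ltnNge.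
  by rewrite lo.
have F_inj : injective F.
  move=> i j /[dup]/F_lt nlt_ij /esym/F_lt nlt_ji.
  by apply: ord_inj; apply: anti_leq; rewrite leqNgt nlt_ji leqNgt nlt_ij.
have := leq_card F F_inj.
by rewrite !card_prod !card_ord cardfE.
Qed.

(** * Absorbing the logarithm *)

Lemma ln2_ge (R : realType) : 2^-1 <= ln (2 : R).
Proof.
have := @le_ln1Dx R (- 2^-1).
have -> : 1 - 2^-1 = 2^-1 :> R by lra.
rewrite lnV ?posrE // lerN2; apply; lra.
Qed.

Lemma trinomial_discriminants_gt0 n H : (1 < n)%N -> (0 < H)%N ->
  (0 < #|` fset_set (trinomial_discriminants n H)|)%N.
Proof.
move=> n_gt1 H_gt0; have mon_f := monic_trinomial 1 1 n_gt1.
have [|K [d [gen_K disc_d]]] := exists_discriminant mon_f.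
  by rewrite size_trinomial // ltnS ltnW.
rewrite cardfs_gt0; apply/fset0Pn; exists d.
rewrite in_fset_set; last exact: finite_trinomial_discriminants.
by rewrite inE /=; exists 1, 1, K; split; rewrite // lexx lez_nat.
Qed.

Lemma trunc_log_le (R : realType) n k H : (0 < n)%N -> (0 < H)%N ->
  (trunc_log 2 ((n * H) ^ k))%:R <= 2 * k%:R * (ln n%:R + ln H%:R) :> R.
Proof.
move=> n_gt0 H_gt0; set L := trunc_log _ _.
have nHk_gt0 : (0 < (n * H) ^ k)%N by rewrite expn_gt0 muln_gt0 n_gt0 H_gt0.
have [lo _] := andP (trunc_log_bounds (isT : 1 < 2)%N nHk_gt0).
have: ln (2 ^ L)%:R <= ln ((n * H) ^ k)%:R :> R.
  by rewrite ler_ln ?posrE ?ltr0n ?nHk_gt0 ?expn_gt0 // ler_nat.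
rewrite !natrX !lnXn ?ltr0n ?muln_gt0 ?n_gt0 // natrM lnM ?posrE ?ltr0n //.
rewrite -[_ *+ L]mulr_natl -[_ *+ k]mulr_natl => leL.
have L_ge0 : 0 <= L%:R :> R by [].
have := le_trans (ler_wpM2l L_ge0 (ln2_ge R)) leL.
by rewrite ler_pdivrMr // [_ * 2]mulrC mulrA.
Qed.

Lemma discriminant_count_ln (R : realType) n : odd n -> (1 < n)%N ->
  exists2 C : R, 0 < C & forall H, (0 < H)%N ->
    H%:R <= C * (1 + ln H%:R) * #|` fset_set (trinomial_discriminants n H)|%:R.
Proof.
move=> odd_n n_gt1; pose k := n./2.
have [A A_gt0 countP] : exists2 A, (0 < A)%N & forall H,
    ((H + 2) %/ 4 <= #|` fset_set (trinomial_discriminants n H)| *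
       (A * A * (trunc_log 2 ((n * H) ^ k)).+1))%N.
  exists (n.-1 ^ n.-1 * 2 ^ n)%N => [|H]; last exact: discriminant_count.
  by rewrite muln_gt0 !expn_gt0 -ltnS prednK ?n_gt1 // ltnW.
have n_gt0 := ltnW n_gt1.
have lnn_ge0 : 0 <= ln n%:R :> R by rewrite ln_ge0 // ler1n.
pose B : R := 1 + 2 * k%:R * (ln n%:R + 1).
have B_gt0 : 0 < B by rewrite ltr_wpDr // !mulr_ge0 // addr_ge0.
exists (9 * (A * A)%:R * B) => [|H H_gt0].
  by rewrite !mulr_gt0 // ltr0n muln_gt0 A_gt0.
have := countP H.
have := trinomial_discriminants_gt0 n_gt1 H_gt0.
move: #|` _| => N N_gt0 leN; set L := trunc_log _ _ in leN.
have lnH_ge0 : 0 <= ln H%:R :> R by rewrite ln_ge0 // ler1n.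
have leL : L.+1%:R <= B * (1 + ln H%:R).
  have := trunc_log_le R k n_gt0 H_gt0; rewrite -/L /B -[L.+1%:R]natr1.
  have : 0 <= k%:R :> R by [].
  move: (L%:R) (k%:R) lnn_ge0 lnH_ge0 => l t.
  move: (ln n%:R) (ln H%:R) => x y; clear => x_ge0 y_ge0 t_ge0 le_l.
  have := mulr_ge0 t_ge0 (mulr_ge0 x_ge0 y_ge0).
  by have := mulr_ge0 t_ge0 y_ge0; lra.
have : (H <= 9 * (N * (A * A * L.+1)))%N.
  have : (0 < N * (A * A * L.+1))%N by rewrite !muln_gt0 N_gt0 A_gt0.
  by move: leN; move: (N * _)%N; clear; lia.
rewrite -(ler_nat R) => /le_trans; apply.
rewrite !natrM.
have -> : 9 * (N%:R * (A%:R * A%:R * L.+1%:R)) =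
  9 * (A%:R * A%:R) * N%:R * L.+1%:R :> R by ring.
have -> : 9 * (A%:R * A%:R) * B * (1 + ln H%:R) * N%:R =
  9 * (A%:R * A%:R) * N%:R * (B * (1 + ln H%:R)) :> R by ring.
by rewrite ler_wpM2l // !mulr_ge0.
Qed.

(** With t = ln H, the loss C (1 + t) is at most exp((2 + 2C) sqrt t) as soon as
    sqrt t >= 1/2, hence for H >= 2: (1 + sqrt t)^2 >= 1 + t accounts for the
    2 sqrt t, and exp(2C sqrt t) >= exp(C) >= C for the rest. So
    o(H) = -(2 + 2C) / sqrt t serves as exponent. *)
Lemma log_loss_exponent (R : realType) (f : nat -> nat) (C : R) :
    0 < C ->
    (forall H, (0 < H)%N -> H%:R <= C * (1 + ln H%:R) * (f H)%:R) ->
  exists2 o : nat -> R, o @ \oo --> (0 : R) &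
    forall H : nat, (0 < H)%N -> H%:R `^ (1 + o H) <= (f H)%:R.
Proof.
move=> C_gt0 leH; pose r (H : nat) : R := Num.sqrt (ln H%:R).
pose c : R := 2 + 2 * C.
exists (fun H => - c * (r H)^-1) => [|H H_gt0].
  rewrite -[0](mulr0 (- c)); apply: cvgMr; apply/gtr0_cvgV0.
    near=> H; rewrite sqrtr_gt0 ln_gt0 //.
    near: H; exact: nbhs_infty_gtr.
  apply/cvgryPge => M; near=> H.
  have HM : expR (M ^+ 2) <= H%:R by near: H; exact: nbhs_infty_ger.
  rewrite (le_trans (ler_norm M)) // -sqrtr_sqr ler_wsqrtr //.
  rewrite -[X in X <= _]expRK ler_ln ?posrE ?expR_gt0 //.
  by rewrite (lt_le_trans _ HM) ?expR_gt0.
have H_pos : 0 < H%:R :> R by rewrite ltr0n.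
have [H1|H_gt1] := leqP H 1.
  have -> : H = 1%N by lia.
  rewrite powR1 ler1n lt0n; apply/eqP => f1.
  by have := leH 1%N isT; rewrite f1 mulr0 ler10.
have lnH_ge : 2^-1 <= ln H%:R :> R.
  by rewrite (le_trans (ln2_ge R)) // ler_ln ?posrE // ler_nat.
have r2 : r H ^+ 2 = ln H%:R by rewrite sqr_sqrtr // (le_trans _ lnH_ge).
have r_ge : 2^-1 <= r H.
  rewrite -(@ler_pXn2r _ 2) ?nnegrE ?sqrtr_ge0 // r2.
  by rewrite (le_trans _ lnH_ge) // expr2; lra.
have r_gt0 : 0 < r H by rewrite (lt_le_trans _ r_ge).
have e_ge : C * (1 + ln H%:R) <= expR (c * r H).
  have -> : c * r H = 2 * C * r H + r H + r H by rewrite /c; ring.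
  rewrite !expRD -r2.
  have e1 : 1 + r H <= expR (r H) := expR_ge1Dx _.
  have e2 : C <= expR (2 * C * r H).
    by apply: (le_trans _ (expR_ge1Dx _)); nra.
  rewrite -mulrA ler_pM ?(ltW C_gt0) ?addr_ge0 ?sqr_ge0 //.
  apply: (le_trans _ (ler_pM _ _ e1 e1)); rewrite ?addr_ge0 ?ltW //; nra.
rewrite /powR gt_eqF // mulrDl mul1r expRD lnK ?posrE //.
rewrite -r2 (_ : - c * _ * _ = - (c * r H)); last first.
  by field; rewrite gt_eqF.
rewrite expRN ler_pdivrMr ?expR_gt0 // (le_trans (leH H H_gt0)) // mulrC.
by rewrite ler_wpM2l.
Unshelve. all: by end_near. Qed.

Theorem corollary1p6 (R : realType) (n : nat) (n_ge2 : (2 <= n)%N)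
    (n_mod4 : n = 1 %[mod 4]) :
  exists2 o : nat -> R, o @ \oo --> (0 : R) &
    forall H : nat, (0 < H)%N ->
      H%:R `^ (1 + o H) <= #|` fset_set (trinomial_discriminants n H)|%:R :> R.
Proof.
have odd_n : odd n by rewrite (divn_eq n 4) n_mod4 oddD oddM andbF.
have [C C_gt0 leH] := discriminant_count_ln R odd_n n_ge2.
exact: log_loss_exponent C_gt0 leH.
Qed.
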